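(* Let $(n,k,r)$ be an admissible triple of parameters, i.e. $n\in\mathbb{N}$, $k\in\{0,\ldots,n\}$, $r\in[0,\infty)$ and $\max\{k,r\}>0$. Then the variance of an $r$-Lah distributed random variable $\mathrm{Lah}(n,k)_r$ is given by $$\begin{aligned} &\mathrm{Var}[\mathrm{Lah}(n,k)_r]=\frac{1}{(n-k+1)(n-k+2)}\biggl(\bigl(r(n^2+3n+2)+k^2(n+r)+k(n^2+r+2nr)\bigr)\bigl(H_{n+2r}-H_{k+2r-1}\bigr)\\ &\quad-\bigl(r^2(n^2+3n+2)+k^2(n+r)^2+k(2n^2r+r(2+r)+n(1+2r+2r^2))\bigr)\bigl(H^{(2)}_{n+2r}-H^{(2)}_{k+2r-1}\bigr)\\ &\quad-\left(\frac{k(n+1)(n+2r)(k+2r-1)}{n-k+1}\right)\bigl(H_{n+2r}-H_{k+2r-1}\bigr)^2\biggr)-\frac{rn+r^2}{(n+2r)^2}. \end{aligned}$$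
   Context: $\mathbb{N}=\{1,2,\ldots\}$, $\mathbb{N}_0=\mathbb{N}\cup\{0\}$. Let $\genfrac{[}{]}{0pt}{}{n}{k}$ and $\genfrac{\{}{\}}{0pt}{}{n}{k}$ be the (unsigned) Stirling numbers of the first kind (number of permutations of $\{1,\dots,n\}$ with exactly $k$ cycles) and of the second kind (number of partitions of $\{1,\dots,n\}$ into $k$ non-empty subsets). For $n\in\mathbb{N}_0$, $k\in\{0,\ldots,n\}$ and $r\in\mathbb{R}$ the $r$-Stirling numbers are defined (with $0^0=1$) by $$\genfrac{[}{]}{0pt}{}{n}{k}_r=\sum_{j=k}^n\genfrac{[}{]}{0pt}{}{n}{j}\binom{j}{k}r^{j-k},\qquad \genfrac{\{}{\}}{0pt}{}{n}{k}_r=\sum_{j=k}^n\binom{n}{j}\genfrac{\{}{\}}{0pt}{}{j}{k}r^{n-j}.$$ The $r$-Lah number is $L(n,k)_r=\sum_{j=k}^n\genfrac{[}{]}{0pt}{}{n}{j}_r\genfrac{\{}{\}}{0pt}{}{j}{k}_r$. For an admissible triple $(n,k,r)$, $\mathrm{Lah}(n,k)_r$ denotes a random variable with the $r$-Lah distribution $$\mathbb{P}[\mathrm{Lah}(n,k)_r=j]=\frac{1}{L(n,k)_r}\genfrac{[}{]}{0pt}{}{n}{j}_r\genfrac{\{}{\}}{0pt}{}{j}{k}_r,\qquad j\in\{k,k+1,\ldots,n\}.$$ Harmonic differences with real arguments: for integer $m\in\mathbb{N}_0$ and real $\alpha>-1$, $H_{\alpha+m}-H_\alpha:=\sum_{i=1}^{m}\frac{1}{\alpha+i}$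 and $H^{(2)}_{\alpha+m}-H^{(2)}_\alpha:=\sum_{i=1}^{m}\frac{1}{(\alpha+i)^2}$. *)

(* Defs.v *)
From HB Require Import structures.
From mathcomp Require Import all_boot all_order all_fingroup all_algebra.
From mathcomp Require Import all_classical all_reals all_analysis.

Set Implicit Arguments.
Unset Strict Implicit.
Unset Printing Implicit Defensive.

Import Order.TTheory GRing.Theory Num.Theory.
Import numFieldNormedType.Exports.

Local Open Scope ring_scope.

(* [porbits s] is the set of all cycles of [s], fixed points included. *)
Definition stirling1 (n k : nat) : nat :=
  #|[pred s : 'S_n | #|porbits s| == k]|.

(* [finset.partition] requires the blocks to be non-empty. *)
Definition stirling2 (n k : nat) : nat :=
  #|[pred B : {set {set 'I_n}} | finset.partition B [set: 'I_n]%SET & #|B| == k]|.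

Definition rstirling1 (R : realType) (r : R) (n k : nat) : R :=
  \sum_(k <= j < n.+1) (stirling1 n j)%:R * 'C(j, k)%:R * r ^+ (j - k).

Definition rstirling2 (R : realType) (r : R) (n k : nat) : R :=
  \sum_(k <= j < n.+1) 'C(n, j)%:R * (stirling2 j k)%:R * r ^+ (n - j).

Definition rLah (R : realType) (r : R) (n k : nat) : R :=
  \sum_(k <= j < n.+1) rstirling1 r n j * rstirling2 r j k.

Definition rLah_distributed (R : realType) (d : measure_display)
    (T : measurableType d) (P : probability T R) (X : {RV P >-> R})
    (n k : nat) (r : R) : Prop :=
  forall j : nat, (k <= j <= n)%N ->
    distribution P X [set j%:R]%classic
    = ((rLah r n k)^-1 * (rstirling1 r n j * rstirling2 r j k))%:E.

(* H^(p)_(a + m) - H^(p)_a, for real a > -1. *)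
Definition harmonic_diff (R : realType) (p : nat) (a : R) (m : nat) : R :=
  \sum_(1 <= i < m.+1) ((a + i%:R) ^+ p)^-1.

Definition rLah_admissible (R : realType) (n k : nat) (r : R) : Prop :=
  [/\ (0 < n)%N, (k <= n)%N, 0 <= r & 0 < Num.max k%:R r].

(* Main.v *)
Require Import Defs.
From HB Require Import structures.
From mathcomp Require Import all_boot all_order all_fingroup all_algebra.
From mathcomp Require Import all_classical all_reals all_analysis.
From mathcomp Require Import measurable_realfun ring zify.

Set Implicit Arguments.
Unset Strict Implicit.
Unset Printing Implicit Defensive.

Import Order.TTheory GRing.Theory Num.Theory.
Import numFieldNormedType.Exports.

Local Open Scope ring_scope.

(* Write q_l(x) = x (x + 1) ... (x + l - 1). The r-Stirling numbers of the first
   kind are the coefficients of q_n(x + r), and k! {j k}_r is the k-th forward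
   difference of x^j at r. Hence k! times the i-th factorial moment of the
   unnormalised r-Lah weights is the k-th forward difference of
   x^i q_n^(i)(x + r) at r. Differences commute with derivatives, and the s-th
   difference of q_n is a shift of n (n - 1) ... (n - s + 1) q_(n - s), so the
   discrete Leibniz rule evaluates all the factorial moments: with a = k + 2 r
   and m = n - k, the i-th one is
     sum_(s <= i) {i s}_r k (k - 1) ... (k - s + 1)
       (q_s(n + 2 r) / q_s(m + 1)) (q_(m + s)^(i)(a) / q_(m + s)(a)).
   The logarithmic derivatives needed for i = 1, 2 are harmonic differences. *)

Lemma ffactD n k l : (n ^_ (k + l) = n ^_ k * (n - k) ^_ l)%N.
Proof.
elim: l => [|l IHl]; first by rewrite addn0 muln1.
by rewrite addnS !ffactnSr IHl subnDA mulnA.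
Qed.

Lemma eq_big_ord_support (T : Type) (idx : T) (op : Monoid.law idx)
    (F : nat -> T) m n :
    (forall i, (minn m n <= i)%N -> F i = idx) ->
  \big[op/idx]_(i < m) F i = \big[op/idx]_(i < n) F i.
Proof.
move=> F_idx; have big_minn l : (minn m n <= l)%N ->
    \big[op/idx]_(i < l) F i = \big[op/idx]_(i < minn m n) F i.
  move=> mn_le_l; rewrite [RHS](big_ord_widen l) // [RHS]big_mkcond.
  by apply: eq_bigr => i _; case: ltnP => // /F_idx.
by rewrite !big_minn // ?geq_minl ?geq_minr.
Qed.

Lemma addr_natr_subnKC (R : pzSemiRingType) k n (c : R) :
  (k <= n)%N -> k%:R + c + (n - k)%:R = n%:R + c.
Proof. by move=> k_le_n; rewrite addrAC -natrD subnKC. Qed.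

Lemma addr_natr_gt0W (R : numDomainType) k n (c : R) :
  (k <= n)%N -> 0 < k%:R + c -> 0 < n%:R + c.
Proof. by move=> k_le_n /lt_le_trans; apply; rewrite lerD2r ler_nat. Qed.

Definition rising {R : pzSemiRingType} (n : nat) (x : R) : R :=
  \prod_(i < n) (x + i%:R).

Section RisingFactorial.
Variable R : comPzSemiRingType.
Implicit Types (m n : nat) (x : R).

Lemma rising0 x : rising 0 x = 1.
Proof. by rewrite /rising big_ord0. Qed.

Lemma risingSr n x : rising n.+1 x = rising n x * (x + n%:R).
Proof. by rewrite /rising big_ord_recr. Qed.

Lemma risingS n x : rising n.+1 x = x * rising n (x + 1).
Proof.
rewrite /rising big_ord_recl addr0; congr (_ * _); apply: eq_bigr => i _.
by rewrite -addrA -mulrS.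
Qed.

Lemma rising1 x : rising 1 x = x.
Proof. by rewrite risingS rising0 mulr1. Qed.

Lemma rising2 x : rising 2 x = x * (x + 1).
Proof. by rewrite risingS rising1. Qed.

Lemma risingD m n x : rising (m + n) x = rising m x * rising n (x + m%:R).
Proof.
rewrite /rising big_split_ord /=; congr (_ * _); apply: eq_bigr => i _.
by rewrite natrD addrA.
Qed.

End RisingFactorial.

Lemma natr_ffact (R : comPzRingType) m n :
  (m ^_ n)%:R = rising n (m%:R - n%:R + 1) :> R.
Proof.
elim: n => [|n IHn]; first by rewrite rising0.
rewrite ffactnSr natrM IHn risingS mulrS opprD (addrC (- _)) addrA addrNK mulrC.
have [n_le_m|m_lt_n] := leqP n m; first by rewrite natrB.
by rewrite -IHn ffact_small // !mulr0.
Qed.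

Lemma rising_natrS (R : comPzRingType) m n :
  rising n (m%:R + 1) = ((m + n) ^_ n)%:R :> R.
Proof. by rewrite natr_ffact natrD addrK. Qed.

Lemma rising_gt0 (R : numDomainType) n (x : R) : 0 < x -> 0 < rising n x.
Proof. by move=> x_gt0; apply: prodr_gt0 => i _; rewrite ltr_wpDr. Qed.

Lemma rmorph_rising (R S : pzSemiRingType) (f : {rmorphism R -> S}) n x :
  f (rising n x) = rising n (f x).
Proof.
by rewrite rmorph_prod; apply: eq_bigr => i _; rewrite rmorphD rmorph_nat.
Qed.

Lemma card_porbits_leq (T : finType) (s : {perm T}) : (#|porbits s| <= #|T|)%N.
Proof. exact: leq_imset_card. Qed.

Section PermutationCycles.
Import boot.finset.
Local Open Scope set_scope.
Variable n : nat.
Implicit Types (i : 'I_n.+1) (s : 'S_n).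

Lemma lift_permX i s m :
  (lift_perm i i s ^+ m)%g = lift_perm i i (s ^+ m)%g.
Proof.
by elim: m => [|m IHm]; rewrite ?lift_perm1 // !expgS IHm lift_permM.
Qed.

Lemma porbit_lift_perm i s (x : 'I_n) :
  porbit (lift_perm i i s) (lift i x) = lift i @: porbit s x.
Proof.
apply/setP => y; apply/porbitP/imsetP => [[m ->]|[_ /porbitP[m ->] ->]].
  by exists ((s ^+ m)%g x); rewrite ?mem_porbit // lift_permX lift_perm_lift.
by exists m; rewrite lift_permX lift_perm_lift.
Qed.

Lemma porbit_lift_perm_id i s : porbit (lift_perm i i s) i = [set i].
Proof.
apply/setP => y; rewrite in_set1; apply/porbitP/eqP => [[m ->]|->].
  by rewrite lift_permX lift_perm_id.
by exists 0%N; rewrite perm1.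
Qed.

Lemma porbits_lift_perm i s :
  porbits (lift_perm i i s)
  = [set i] |: [set lift i @: A | A : {set 'I_n} in porbits s].
Proof.
apply/setP => A; rewrite in_setU1.
apply/imsetP/orP => [[x _ ->]|[/eqP->|/imsetP[_ /imsetP[x _ ->] ->]]].
- case: (unliftP i x) => [y|] ->; last by left; rewrite porbit_lift_perm_id.
  by right; rewrite porbit_lift_perm; apply/imset_f/imset_f.
- by exists i; rewrite ?porbit_lift_perm_id.
- by exists (lift i x); rewrite ?porbit_lift_perm.
Qed.

Lemma card_porbits_lift_perm i s :
  #|porbits (lift_perm i i s)| = #|porbits s|.+1.
Proof.
rewrite porbits_lift_perm cardsU1 card_imset; last exact/imset_inj/lift_inj.
case: imsetP => // -[A _ iA]; have: i \in lift i @: A by rewrite -iA in_set1.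
by case/imsetP => x _ /eqP; rewrite (negPf (neq_lift _ _)).
Qed.

Lemma card_porbits_tperm_lift_perm i j s :
  #|porbits (tperm i j * lift_perm i i s)%g| = (#|porbits s| + (j == i))%N.
Proof.
have := porbits_mul_tperm (lift_perm i i s) i j.
rewrite /= card_porbits_lift_perm porbit_sym porbit_lift_perm_id in_set1 eq_sym.
by case: eqP => _ /=; lia.
Qed.

Lemma big_perm_lift (T : Type) (idx : T) (op : Monoid.com_law idx) i
    (F : 'S_n.+1 -> T) :
  \big[op/idx]_s F s
  = \big[op/idx]_j \big[op/idx]_(s : 'S_n) F (tperm i j * lift_perm i i s)%g.
Proof.
(* Every permutation is uniquely a permutation fixing i precomposed with a
   transposition (i j). *)
pose f (js : 'I_n.+1 * 'S_n) := (tperm i js.1 * lift_perm i i js.2)%g.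
have fVi js : (f js)^-1%g i = js.1.
  by apply: (@perm_inj _ (f js)); rewrite permKV permM tpermR lift_perm_id.
have f_inj : injective f.
  move=> [j s] [k t] fjk; have jk : j = k by rewrite -[j](fVi (j, s)) fjk fVi.
  move: fjk; rewrite /f jk => /mulgI/permP stE; congr (_, _); apply/permP => x.
  by apply: (@lift_inj _ i); rewrite -!(lift_perm_lift i i) stE.
rewrite (reindex f) ?pair_big //; apply/onW_bij/inj_card_bij => //.
by rewrite card_prod card_ord !card_Sn factS.
Qed.

End PermutationCycles.

Section Stirling1.
Variable R : comPzSemiRingType.
Implicit Types (n : nat) (x : R).

Lemma sum_exp_porbits n x : \sum_(s : 'S_n) x ^+ #|porbits s| = rising n x.
Proof.
elim: n => [|n IHn].
  rewrite rising0 (bigD1 1%g) //= big1 => [|s /eqP[]]; last first.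
    by apply/permP => -[].
  by rewrite addr0 eq_card0 // => A; apply/finset.imsetP => -[[]].
rewrite (big_perm_lift _ ord0) risingSr -IHn big_ord_recl /= mulrDr mulr_suml.
congr (_ + _).
  by apply: eq_bigr => s _; rewrite card_porbits_tperm_lift_perm addn1 exprSr.
rewrite (eq_bigr (fun=> \sum_(s : 'S_n) x ^+ #|porbits s|)) => [|j _].
  by rewrite sumr_const card_ord mulr_natr.
by apply: eq_bigr => s _; rewrite card_porbits_tperm_lift_perm addn0.
Qed.

Lemma sum_stirling1_exp n x :
  \sum_(j < n.+1) (stirling1 n j)%:R * x ^+ j = rising n x.
Proof.
pose cycles (s : 'S_n) : 'I_n.+1 := inord #|porbits s|.
have cyclesE s j : (cycles s == j) = (#|porbits s| == j).
  by rewrite -val_eqE /= inordK // ltnS -[leqRHS]card_ord card_porbits_leq.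
rewrite -sum_exp_porbits (partition_big cycles xpredT) //=.
apply: eq_bigr => j _; rewrite mulr_natl -sumr_const.
apply: eq_big => s; first by rewrite cyclesE.
by rewrite inE => /eqP <-.
Qed.

End Stirling1.

Section SetPartitions.
Import boot.finset.
Local Open Scope set_scope.
Implicit Types T Q U : finType.

Lemma card_partition_leq T (B : {set {set T}}) (D : {set T}) :
  partition B D -> (#|B| <= #|D|)%N.
Proof.
move=> partB; rewrite (card_partition partB) -sum1_card.
have [_ _ setB0] := and3P partB; apply: leq_sum => A AB.
by rewrite card_gt0; apply: contraNneq setB0 => <-.
Qed.

Lemma eq_preim_partitionP T (U V : eqType) (f : T -> U) (g : T -> V)
    (D : {set T}) :
  reflect {in D &, forall x y, (f x == f y) = (g x == g y)}
          (preim_partition f D == preim_partition g D).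
Proof.
have pblock_preim (W : eqType) (h : T -> W) :
    {in D &, forall x y, (y \in pblock (preim_partition h D) x) = (h x == h y)}.
  by apply: pblock_equivalence_partition; split=> // /eqP ->.
apply: (iffP eqP) => [fg x y xD yD|fg]; first by rewrite -!pblock_preim ?fg.
apply: eq_in_imset => x xD; apply/setP => y; rewrite !inE.
by case yD: (y \in D); rewrite //= fg.
Qed.

Lemma card_ffun_preim_partition T Q U (q : T -> Q) :
    (forall b, exists x, q x = b) ->
  #|[set f : {ffun T -> U} | preim_partition f setT == preim_partition q setT]|
  = (#|U| ^_ #|Q|)%N.
Proof.
case/fin_all_exists => h qh.
(* A map has the same kernel as q iff it is an injection composed with q. *)
pose comp_q (g : {ffun Q -> U}) : {ffun T -> U} := [ffun x => g (q x)].
have comp_q_inj : injective comp_q.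
  move=> g g' /ffunP gg'; apply/ffunP => b.
  by have := gg' (h b); rewrite !ffunE qh.
rewrite -card_inj_ffuns -(card_imset _ comp_q_inj); apply: eq_card => f.
rewrite inE; apply/eq_preim_partitionP/imsetP => [fq|[g]].
  exists [ffun b => f (h b)].
    rewrite inE; apply/injectiveP => b c; rewrite !ffunE => /eqP.
    by rewrite fq ?inE // !qh => /eqP.
  by apply/ffunP => x; rewrite !ffunE; apply/eqP; rewrite fq ?inE // qh.
by rewrite inE => /injectiveP g_inj -> x y _ _; rewrite !ffunE (inj_eq g_inj).
Qed.

Lemma card_ffun_kernel T U (B : {set {set T}}) :
    partition B setT ->
  #|[set f : {ffun T -> U} | preim_partition f setT == B]| = (#|U| ^_ #|B|)%N.
Proof.
move=> partB; have [/eqP coverB trivB setB0] := and3P partB.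
have pblockB x : pblock B x \in B by rewrite pblock_mem // coverB inE.
pose block x : {A | A \in B} := exist _ (pblock B x) (pblockB x).
have blockK (A : {A | A \in B}) : exists x, block x = A.
  have /set0Pn[x xA] : val A != set0.
    by apply: contraNneq setB0 => <-; apply: valP.
  by exists x; apply/val_inj/(def_pblock trivB _ xA)/valP.
rewrite -[#|B|]card_sig -(card_ffun_preim_partition U blockK).
by rewrite -[in LHS](preim_partition_pblock partB).
Qed.

End SetPartitions.

Lemma stirling2_small n k : (n < k)%N -> stirling2 n k = 0%N.
Proof.
move=> n_lt_k; apply: eq_card0 => B; rewrite !inE.
apply/andP => -[/card_partition_leq + /eqP cardB].
by rewrite finset.cardsT card_ord cardB leqNgt n_lt_k.
Qed.

Lemma sum_stirling2_ffact n m :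
  (\sum_(j < n.+1) stirling2 n j * m ^_ j = m ^ n)%N.
Proof.
pose kernel (f : {ffun 'I_n -> 'I_m}) := preim_partition f [set: 'I_n]%SET.
pose part := finset.partition^~ [set: 'I_n]%SET.
have part_kernel (f : {ffun 'I_n -> 'I_m}) : true -> part (kernel f).
  by move=> _; exact: preim_partitionP.
pose size_part (B : {set {set 'I_n}}) : 'I_n.+1 := inord #|B|.
have size_partE B : part B -> size_part B = #|B| :> nat.
  by move/card_partition_leq; rewrite finset.cardsT card_ord => /inordK.
have -> : (m ^ n = \sum_(f : {ffun 'I_n -> 'I_m}) 1)%N.
  by rewrite sum1_card card_ffun !card_ord.
rewrite (partition_big kernel part) //=.
rewrite [RHS](partition_big size_part xpredT) //=; apply: eq_bigr => j _.
rewrite -sum_nat_const; apply: eq_big => B; rewrite unfold_in /= -/(part B).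
  by apply: andb_id2l => /size_partE partB; rewrite -val_eqE /= partB.
case/andP => partB /eqP <-; rewrite -[m in LHS]card_ord -card_ffun_kernel //.
by rewrite -sum1_card; apply: eq_bigl => f; rewrite finset.in_set.
Qed.

Lemma rising_comp_poly (R : comNzRingType) n (p q : {poly R}) :
  rising n p \Po q = rising n (p \Po q).
Proof. exact: (rmorph_rising (comp_poly q)). Qed.

Lemma horner_rising (R : comNzRingType) n (p : {poly R}) x :
  (rising n p).[x] = rising n p.[x].
Proof. exact: (rmorph_rising (horner_eval x)). Qed.

Lemma derivn_mul_XaddC (R : comNzRingType) i (p : {poly R}) c :
  (p * ('X + c%:P))^`(i.+1) = p^`(i) *+ i.+1 + p^`(i.+1) * ('X + c%:P).
Proof.
rewrite !mulrDr addrA -(derivnMXaddC _ _ 0) addr0 derivnD.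
by rewrite ![_ * c%:P]mulrC !mul_polyC derivnZ.
Qed.

Lemma horner_derivn_risingS (R : comNzRingType) m i (x : R) :
  (rising m.+1 'X)^`(i.+1).[x]
  = (rising m 'X)^`(i).[x] *+ i.+1 + (rising m 'X)^`(i.+1).[x] * (x + m%:R).
Proof.
rewrite risingSr -polyC_natr derivn_mul_XaddC.
by rewrite hornerD hornerMn hornerM hornerD hornerX hornerC.
Qed.

Section ForwardDifference.
Variable R : comNzRingType.
Implicit Types (p q : {poly R}) (c x : R) (i k n : nat).

Definition fdiff p : {poly R} := p \Po ('X + 1%:P) - p.
Definition fdiffn k p : {poly R} := iter k fdiff p.

Lemma fdiff_is_linear : linear fdiff.
Proof. by move=> c p q; rewrite /fdiff linearP scalerBr opprD addrACA. Qed.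

HB.instance Definition _ :=
  GRing.isLinear.Build R {poly R} {poly R} _ fdiff fdiff_is_linear.

Lemma fdiffnS k p : fdiffn k.+1 p = fdiff (fdiffn k p).
Proof. by []. Qed.

Lemma fdiffn_is_linear k : linear (fdiffn k).
Proof. by move=> c p q; elim: k => // k IHk; rewrite !fdiffnS IHk linearP. Qed.

HB.instance Definition _ k :=
  GRing.isLinear.Build R {poly R} {poly R} _ (fdiffn k) (fdiffn_is_linear k).

Lemma comp_poly_XaddC c c' p :
  (p \Po ('X + c%:P)) \Po ('X + c'%:P) = p \Po ('X + (c + c')%:P).
Proof.
rewrite -comp_polyA comp_polyD comp_polyX comp_polyC.
by rewrite polyCD addrA [in RHS]addrAC.
Qed.

Lemma horner_comp_XaddC p c x : (p \Po ('X + c%:P)).[x] = p.[x + c].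
Proof. by rewrite horner_comp hornerD hornerX hornerC. Qed.

Lemma derivn_comp_XaddC i p c :
  (p \Po ('X + c%:P))^`(i) = p^`(i) \Po ('X + c%:P).
Proof.
elim: i p => [|i IHi] p; first by rewrite !derivn0.
by rewrite !derivSn deriv_comp derivD derivX derivC addr0 mulr1 IHi.
Qed.

Lemma horner_fdiff p x : (fdiff p).[x] = p.[x + 1] - p.[x].
Proof. by rewrite hornerD hornerN horner_comp_XaddC. Qed.

Lemma eq_horner_fdiffn k p q x :
    (forall i, p.[x + i%:R] = q.[x + i%:R]) ->
  (fdiffn k p).[x] = (fdiffn k q).[x].
Proof.
elim: k x => [|k IHk] x pq; first by have := pq 0; rewrite addr0.
by rewrite !horner_fdiff !IHk // => i; rewrite -addrA -mulrS.
Qed.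

Lemma fdiff_comp_XaddC p c :
  fdiff (p \Po ('X + c%:P)) = fdiff p \Po ('X + c%:P).
Proof. by rewrite /fdiff comp_polyB !comp_poly_XaddC (addrC c). Qed.

Lemma fdiffn_comp_XaddC k p c :
  fdiffn k (p \Po ('X + c%:P)) = fdiffn k p \Po ('X + c%:P).
Proof. by elim: k => // k IHk; rewrite !fdiffnS IHk fdiff_comp_XaddC. Qed.

Lemma fdiffn_derivn k i p : fdiffn k p^`(i) = (fdiffn k p)^`(i).
Proof.
by elim: k => // k IHk; rewrite !fdiffnS IHk [RHS]linearB /= derivn_comp_XaddC.
Qed.

Lemma fdiffM p q : fdiff (p * q) = fdiff p * (q \Po ('X + 1%:P)) + p * fdiff q.
Proof. by rewrite /fdiff comp_polyM; ring. Qed.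

Lemma fdiffnM k p q :
  fdiffn k (p * q)
  = \sum_(s < k.+1)
      (fdiffn s p * (fdiffn (k - s) q \Po ('X + s%:R%:P))) *+ 'C(k, s).
Proof.
elim: k => [|k IHk]; first by rewrite big_ord1 mulr1n addr0 comp_polyXr.
pose t s l := fdiffn s p * (fdiffn l q \Po ('X + s%:R%:P)).
have fdiff_t s l : fdiff (t s l) = t s.+1 l + t s l.+1.
  rewrite fdiffM comp_poly_XaddC natr1; congr (_ + _ * _).
  by rewrite fdiff_comp_XaddC.
rewrite fdiffnS IHk raddf_sum /=; under eq_bigr => s _.
  rewrite raddfMn /= fdiff_t -subSn -1?ltnS // mulrnDl; over.
rewrite big_split /= addrC [RHS]big_ord_recl /=.
under [in RHS]eq_bigr => s _ do rewrite binS mulrnDr.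
rewrite big_split /= addrA; congr (_ + _).
transitivity (\sum_(s < k.+2) t s (k.+1 - s)%N *+ 'C(k, s)).
  by rewrite [RHS]big_ord_recr /= bin_small // mulr0n addr0.
by rewrite big_ord_recl !bin0.
Qed.

Lemma fdiff_rising n c :
  fdiff (rising n ('X + c%:P)) = n%:R *: rising n.-1 ('X + (c + 1)%:P).
Proof.
rewrite /fdiff rising_comp_poly comp_polyD comp_polyX comp_polyC.
rewrite -addrA -(addrC c%:P) -polyCD; case: n => [|n].
  by rewrite !rising0 subrr scale0r.
rewrite risingSr risingS -mul_polyC polyC_natr polyCD addrA mulrS /=.
by ring.
Qed.

Lemma fdiffn_rising k n c :
  fdiffn k (rising n ('X + c%:P))
  = (n ^_ k)%:R *: rising (n - k) ('X + (c + k%:R)%:P).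
Proof.
elim: k => [|k IHk]; first by rewrite subn0 addr0 scale1r.
rewrite fdiffnS IHk linearZ /= fdiff_rising scalerA -natrM -ffactnSr -subnS.
by rewrite -addrA natr1.
Qed.

Lemma horner_fdiffn_derivn_rising k n i c x :
  (fdiffn k (rising n ('X + c%:P))^`(i)).[x]
  = (n ^_ k)%:R * (rising (n - k) 'X)^`(i).[x + c + k%:R].
Proof.
have rising_comp l (e : R) : rising l ('X + e%:P) = rising l 'X \Po ('X + e%:P).
  by rewrite rising_comp_poly comp_polyX.
rewrite fdiffn_derivn fdiffn_rising rising_comp linearZ hornerZ /=.
by rewrite derivn_comp_XaddC horner_comp_XaddC addrA.
Qed.

(* X (X - 1) ... (X - n + 1) *)
Definition ffactp n : {poly R} := rising n ('X + (1 - n%:R)%:P).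

Lemma horner_ffactp_natr n m : (ffactp n).[m%:R] = (m ^_ n)%:R.
Proof.
by rewrite horner_rising hornerD hornerX hornerC natr_ffact -addrA (addrC 1).
Qed.

Lemma horner_fdiffn_ffactp_0 k n :
  (fdiffn k (ffactp n)).[0] = (k`! * (n == k))%:R.
Proof.
rewrite fdiffn_rising hornerZ horner_rising hornerD hornerX hornerC add0r.
have [n_lt_k|k_lt_n|->] := ltngtP n k.
- by rewrite ffact_small // mul0r muln0.
- have -> : 1 - n%:R + k%:R = 0%:R - (n - k)%:R + 1 :> R.
    by rewrite natrB 1?ltnW //; ring.
  by rewrite -natr_ffact ffact0n subn_eq0 leqNgt k_lt_n mulr0 muln0.
- by rewrite ffactnn subnn rising0 mulr1 muln1.
Qed.

Lemma horner_fdiffn_Xn_0 k n : (fdiffn k 'X^n).[0] = (k`! * stirling2 n k)%:R.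
Proof.
rewrite (@eq_horner_fdiffn _ _
  (\sum_(j < n.+1) (stirling2 n j)%:R *: ffactp j)) => [|i].
  pose c : R := (k`! * stirling2 n k)%:R.
  rewrite linear_sum horner_sum.
  rewrite (eq_bigr (fun j : 'I__ => if j == k :> nat then c else 0)) => [|j _].
    rewrite -big_mkcond (big_ord1_eq _ (fun=> c)) ltnS /c.
    by have [//|/stirling2_small ->] := leqP; rewrite muln0.
  rewrite linearZ hornerZ horner_fdiffn_ffactp_0 -natrM mulnCA.
  by case: eqP => [->|_]; rewrite ?muln1 ?muln0 // mulnC.
rewrite add0r hornerXn -natrX -sum_stirling2_ffact natr_sum horner_sum.
by apply: eq_bigr => j _; rewrite natrM hornerZ horner_ffactp_natr.
Qed.

End ForwardDifference.

Lemma exp_XaddC_poly (R : comNzRingType) n (c : R) :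
  ('X + c%:P) ^+ n = \poly_(i < n.+1) ('C(n, i)%:R * c ^+ (n - i)).
Proof.
rewrite addrC exprDn poly_def; apply: eq_bigr => i _.
by rewrite -polyC_exp mul_polyC scalerMnl mulr_natl.
Qed.

Lemma mulXn_derivn_poly (R : comNzRingType) i n (E : nat -> R) :
  'X^i * (\poly_(j < n) E j)^`(i) = \poly_(j < n) ((j ^_ i)%:R * E j).
Proof.
apply/polyP => j; rewrite coefXnM coef_derivn !coef_poly.
have [j_lt_i|/subnKC->] := ltnP; last by case: ifP; rewrite ?mul0rn ?mulr_natl.
by rewrite ffact_small // mul0r if_same.
Qed.

Section RStirling.
Variables (R : realType) (r : R).
Implicit Types (i j k n : nat).

Lemma rstirling2_small n k : (n < k)%N -> rstirling2 r n k = 0.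
Proof. by move=> n_lt_k; rewrite /rstirling2 big_geq. Qed.

Lemma horner_fdiffn_Xn k n :
  (fdiffn k 'X^n).[r] = k`!%:R * rstirling2 r n k.
Proof.
rewrite -[r in LHS]add0r -horner_comp_XaddC -fdiffn_comp_XaddC comp_Xn_poly.
rewrite exp_XaddC_poly poly_def linear_sum horner_sum mulr_sumr.
rewrite big_geq_mkord [RHS]big_mkcond; apply: eq_bigr => j _.
rewrite linearZ hornerZ horner_fdiffn_Xn_0 natrM.
by case: leqP => [_|/stirling2_small->] /=; [ring | rewrite !mulr0].
Qed.

Lemma rstirling2n0 n : rstirling2 r n 0 = r ^+ n.
Proof. by have := horner_fdiffn_Xn 0 n; rewrite hornerXn mul1r. Qed.

Lemma rstirling2n1 n : rstirling2 r n 1 = (r + 1) ^+ n - r ^+ n.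
Proof.
by have := horner_fdiffn_Xn 1 n; rewrite horner_fdiff !hornerXn mul1r.
Qed.

Lemma rstirling2n2 n :
  rstirling2 r n 2 = ((r + 2) ^+ n - 2 * (r + 1) ^+ n + r ^+ n) / 2.
Proof.
have := horner_fdiffn_Xn 2 n; rewrite !horner_fdiff !hornerXn => fdiff2.
have -> : r + 2 = r + 1 + 1 by ring.
apply: (@mulfI _ 2%:R); first by rewrite pnatr_eq0.
by rewrite -fdiff2; field.
Qed.

Lemma rising_XaddC_poly n :
  rising n ('X + r%:P) = \poly_(k < n.+1) rstirling1 r n k.
Proof.
apply/polyP => k; rewrite -sum_stirling1_exp coef_sum coef_poly.
transitivity (rstirling1 r n k).
  rewrite /rstirling1 big_geq_mkord [RHS]big_mkcond; apply: eq_bigr => j _.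
  rewrite -polyC_natr coefCM exp_XaddC_poly coef_poly ltnS.
  by case: leqP; rewrite ?mulr0 ?mulrA.
by case: ltnP => // n_lt_k; rewrite /rstirling1 big_geq.
Qed.

Definition rLah_ffact_sum n k i : R :=
  \sum_(k <= j < n.+1) (j ^_ i)%:R * (rstirling1 r n j * rstirling2 r j k).

Definition rLah_ffact_moment n k i : R := rLah_ffact_sum n k i / rLah r n k.

Lemma rLah_ffact_sum_fdiffn n k i :
  k`!%:R * rLah_ffact_sum n k i
  = (fdiffn k ('X^i * (rising n ('X + r%:P))^`(i))).[r].
Proof.
rewrite rising_XaddC_poly mulXn_derivn_poly poly_def linear_sum horner_sum.
rewrite /rLah_ffact_sum big_geq_mkord big_mkcond mulr_sumr.
apply: eq_bigr => j _.
rewrite linearZ hornerZ horner_fdiffn_Xn.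
by case: leqP => [_|/rstirling2_small->] /=; [ring | rewrite !mulr0].
Qed.

End RStirling.

Section LogDerivativeRising.
Variables (R : realType) (x : R).
Implicit Types m p : nat.

Lemma harmonic_diffS p m :
  harmonic_diff p (x - 1) m.+1
  = harmonic_diff p (x - 1) m + ((x + m%:R) ^+ p)^-1.
Proof. by rewrite /harmonic_diff big_nat_recr //= mulrS addrA subrK. Qed.

Hypothesis x_gt0 : 0 < x.

Lemma deriv_rising m :
  (rising m 'X)^`(1).[x] = rising m x * harmonic_diff 1 (x - 1) m.
Proof.
elim: m => [|m IHm].
  rewrite !rising0 /harmonic_diff big_geq // mulr0.
  by rewrite derivn_poly0 ?size_poly1 // horner0.
rewrite horner_derivn_risingS IHm derivn0 horner_rising hornerX mulr1n.
by rewrite risingSr harmonic_diffS; field; rewrite gt_eqF // ltr_wpDr.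
Qed.

Lemma deriv2_rising m :
  (rising m 'X)^`(2).[x]
  = rising m x
    * (harmonic_diff 1 (x - 1) m ^+ 2 - harmonic_diff 2 (x - 1) m).
Proof.
elim: m => [|m IHm].
  rewrite !rising0 /harmonic_diff !big_geq // expr0n subr0 mulr0.
  by rewrite derivn_poly0 ?size_poly1 // horner0.
rewrite horner_derivn_risingS IHm deriv_rising -mulr_natl.
by rewrite risingSr !harmonic_diffS; field; rewrite gt_eqF // ltr_wpDr.
Qed.

End LogDerivativeRising.

Section RLahMoments.
Variables (R : realType) (n k : nat) (r : R).
Hypothesis k_le_n : (k <= n)%N.

Local Notation m := (n - k)%N.
Local Notation a := (k%:R + 2 * r).

Lemma rLah_ffact_sumE i :
  k`!%:R * rLah_ffact_sum r n k i
  = (n ^_ k)%:R * \sum_(s < i.+1) rstirling2 r i s * (k ^_ s)%:R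
      / rising s (m%:R + 1) * (rising (m + s) 'X)^`(i).[a].
Proof.
pose t s := rstirling2 r i s * (k ^_ s)%:R
  / rising s (m%:R + 1) * (rising (m + s) 'X)^`(i).[a].
rewrite rLah_ffact_sum_fdiffn fdiffnM horner_sum.
rewrite [in RHS](@eq_big_ord_support _ _ _ t i.+1 k.+1) => [|s]; last first.
  rewrite geq_min /t => /orP[/rstirling2_small->|/ffact_small->].
    by rewrite !mul0r.
  by rewrite mulr0 !mul0r.
rewrite mulr_sumr; apply: eq_bigr => -[s /=]; rewrite ltnS => s_le_k _.
rewrite hornerMn hornerM horner_fdiffn_Xn horner_comp_XaddC.
rewrite horner_fdiffn_derivn_rising -mulr_natl /t -(bin_ffact k s) natrM.
have -> : (n - (k - s) = m + s)%N by lia.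
have -> : r + s%:R + r + (k - s)%:R = a by rewrite natrB //; ring.
have -> : (n ^_ k)%:R = (n ^_ (k - s))%:R * rising s (m%:R + 1) :> R.
  rewrite rising_natrS -natrM -{1}(subnK s_le_k) ffactD.
  by congr (_ * _ ^_ _)%:R; lia.
have rising_neq0 : rising s (m%:R + 1) != 0 :> R.
  by rewrite rising_natrS pnatr_eq0 -lt0n ffact_gt0 leq_addl.
by field.
Qed.

Lemma rLah_rising : k`!%:R * rLah r n k = (n ^_ k)%:R * rising m a.
Proof.
have := rLah_ffact_sumE 0; rewrite /rLah_ffact_sum.
under eq_bigr do rewrite mul1r.
rewrite big_ord1 rstirling2n0 rising0 derivn0 horner_rising hornerX addn0.
by rewrite expr0 mulr1 divr1 mul1r.
Qed.

Hypothesis a_gt0 : 0 < a.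

Lemma rLah_gt0 : 0 < rLah r n k.
Proof.
rewrite -(pmulr_rgt0 _ (_ : 0 < k`!%:R)) ?ltr0n ?fact_gt0 // rLah_rising.
by rewrite mulr_gt0 ?rising_gt0 // ltr0n ffact_gt0.
Qed.

Lemma rLah_ffact_momentE i :
  rLah_ffact_moment r n k i
  = \sum_(s < i.+1) rstirling2 r i s * (k ^_ s)%:R
      * rising s (n%:R + 2 * r) / rising s (m%:R + 1)
      * ((rising (m + s) 'X)^`(i).[a] / rising (m + s) a).
Proof.
have fact_neq0 : k`!%:R != 0 :> R by rewrite pnatr_eq0 -lt0n fact_gt0.
have rLah_neq0 := lt0r_neq0 rLah_gt0.
apply: (mulIf rLah_neq0); rewrite divfK //; apply: (mulfI fact_neq0).
rewrite rLah_ffact_sumE mulrCA rLah_rising [RHS]mulrCA; congr (_ * _).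
rewrite mulr_suml; apply: eq_bigr => s _; rewrite (risingD _ _ a).
rewrite addr_natr_subnKC //; have n2r_gt0 := addr_natr_gt0W k_le_n a_gt0.
by field; rewrite !lt0r_neq0 ?rising_gt0 // ltr_wpDl.
Qed.

Local Notation H1 := (harmonic_diff 1 (a - 1) m.+1).
Local Notation H2 := (harmonic_diff 2 (a - 1) m.+1).
Local Notation v := (n%:R + 2 * r).

Lemma rLah_ffact_moment1 :
  rLah_ffact_moment r n k 1 = (r + k%:R * v / (m%:R + 1)) * H1 - r / v.
Proof.
rewrite rLah_ffact_momentE big_ord_recl big_ord1 /=.
rewrite rstirling2n0 rstirling2n1 ffactn0 ffactn1 !deriv_rising //.
rewrite !rising0 !rising1 addn0 addn1 !harmonic_diffS addr_natr_subnKC //.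
have v_gt0 := addr_natr_gt0W k_le_n a_gt0.
have m1_neq0 : m%:R + 1 != 0 :> R by rewrite natr1 pnatr_eq0.
by field; rewrite m1_neq0 !lt0r_neq0 ?rising_gt0.
Qed.

Lemma rLah_ffact_moment2 :
  rLah_ffact_moment r n k 2
  = (r ^+ 2 + k%:R * (2 * r + 1) * v / (m%:R + 1)
     + k%:R * (k%:R - 1) * v * (v + 1) / ((m%:R + 1) * (m%:R + 2)))
      * (H1 ^+ 2 - H2)
    + 2 * (k%:R * (k%:R - 1) * v / ((m%:R + 1) * (m%:R + 2)) - r ^+ 2 / v) * H1
    + 2 * r ^+ 2 / v ^+ 2.
Proof.
have k_ffact2 : (k ^_ 2)%:R = k%:R * (k%:R - 1) :> R.
  by rewrite natr_ffact rising2; ring.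
rewrite rLah_ffact_momentE 2!big_ord_recl big_ord1 /=.
rewrite rstirling2n0 rstirling2n1 rstirling2n2 ffactn0 ffactn1 k_ffact2.
rewrite !deriv2_rising // !rising0 !rising1 !rising2 addn0 addn1 addn2.
rewrite !harmonic_diffS -[m.+1%:R]natr1 [a + (_ + 1)]addrA addr_natr_subnKC //.
have v_gt0 := addr_natr_gt0W k_le_n a_gt0.
have m1_neq0 : m%:R + 1 != 0 :> R by rewrite natr1 pnatr_eq0.
have m2_neq0 : m%:R + 2 != 0 :> R by rewrite -natrD addn2 pnatr_eq0.
have v1_neq0 : v + 1 != 0 by rewrite lt0r_neq0 // ltr_wpDr.
by field; rewrite m1_neq0 m2_neq0 v1_neq0 !lt0r_neq0 ?rising_gt0.
Qed.

End RLahMoments.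

Section FiniteSupport.
Context d (T : measurableType d) (R : realType).
Local Open Scope classical_set_scope.

Lemma integral_conegligible (mu : {measure set T -> \bar R}) (D : set T)
    (f : T -> \bar R) :
    measurable D -> mu.-negligible (~` D) -> measurable_fun setT f ->
  (\int[mu]_w f w = \int[mu]_(w in D) f w)%E.
Proof.
move=> mD D0 mf; rewrite [RHS]integral_mkcond; apply: ae_eq_integral => //.
  by apply/(measurable_restrictT _ mD); exact: measurable_funTS.
apply: (negligibleS _ D0) => w /= fDf Dw.
by apply: fDf => _; rewrite patchE mem_set.
Qed.

Variables (P : probability T R) (X : {RV P >-> R}).
Variables (I : eqType) (s : seq I) (x p : I -> R).
Hypothesis s_uniq : uniq s.
Hypothesis x_inj : {in s &, injective x}.
Hypothesis X_law : forall i, i \in s -> distribution P X [set x i] = (p i)%:E.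
Hypothesis p_sum1 : \sum_(i <- s) p i = 1.

Lemma expectation_finite_support (f : R -> R) : measurable_fun setT f ->
  ('E_P[f \o X] = (\sum_(i <- s) f (x i) * p i)%:E)%E.
Proof.
move=> mf; pose F i := X @^-1` [set x i].
have mF i : measurable (F i) by rewrite -[F i]setTI; exact: measurable_funP.
have trivF : trivIset [set` s] F.
  move=> i j /= si sj [w [/= Xi Xj]].
  by apply: x_inj => //; rewrite -Xi -Xj.
pose D := \big[setU/set0]_(i <- s) F i.
have mD : measurable D by apply: bigsetU_measurable.
have mfX : measurable_fun setT (f \o X) by exact: measurableT_comp.
have integral_D (g : T -> R) : measurable_fun setT g ->
    (\int[P]_(w in D) (g w)%:E = \sum_(i <- s) \int[P]_(w in F i) (g w)%:E)%E.
  move=> mg; rewrite integral_bigsetU_EFin //.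
  by apply: measurable_funTS; exact/measurable_EFinP.
have D0 : P.-negligible (~` D).
  apply/negligibleP; first exact: measurableC.
  rewrite [LHS](probability_setC P mD) -[P D]mul1e -integral_cst //.
  rewrite integral_D //.
  rewrite (eq_big_seq (fun i => (p i)%:E)) => [|i si].
    by rewrite sumEFin p_sum1 subee.
  by rewrite integral_cst // mul1e -X_law.
rewrite unlock (integral_conegligible mD D0); last exact/measurable_EFinP.
rewrite integral_D // -sumEFin !big_seq; apply: eq_bigr => i si.
rewrite (eq_integral (cst (f (x i))%:E)) => [|w]; last by rewrite inE /= => ->.
by rewrite integral_cst // EFinM -X_law.
Qed.

Lemma variance_finite_support :
  'V_P[X] = (\sum_(i <- s) x i ^+ 2 * p i
             - (\sum_(i <- s) x i * p i) ^+ 2)%:E.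
Proof.
set mean := \sum_(i <- s) x i * p i.
have EX : ('E_P[X] = mean%:E)%E.
  exact: (expectation_finite_support (@measurable_id _ _ setT)).
rewrite /variance covariance.unlock EX /=.
pose sqdev (y : R) := (y - mean) ^+ 2.
transitivity ('E_P[sqdev \o X])%E.
  by congr ('E_P[_])%E; apply/funext => w; rewrite /sqdev /= expr2.
rewrite expectation_finite_support; last first.
  by apply: measurable_funX; apply: measurable_funB.
have sqdevE i : sqdev (x i) * p i
    = x i ^+ 2 * p i - 2 * mean * (x i * p i) + mean ^+ 2 * p i.
  by rewrite /sqdev; ring.
congr EFin; rewrite (eq_bigr _ (fun i _ => sqdevE i)).
by rewrite big_split /= sumrB -!mulr_sumr p_sum1 -/mean; ring.
Qed.

End FiniteSupport.

Lemma rLah_admissible_gt0 (R : realType) n k (r : R) :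
  rLah_admissible n k r -> 0 < k%:R + 2 * r.
Proof.
case=> _ _ r_ge0; rewrite lt_max => /orP[k_gt0|r_gt0].
  by rewrite ltr_wpDr // mulr_ge0.
by rewrite ltr_wpDl // mulr_gt0.
Qed.

Lemma rLah_variance_ffact_moment (R : realType) d (T : measurableType d)
    (P : probability T R) (X : {RV P >-> R}) n k (r : R) :
    rLah r n k != 0 -> rLah_distributed X n k r ->
  'V_P[X] = (rLah_ffact_moment r n k 2 + rLah_ffact_moment r n k 1
             - rLah_ffact_moment r n k 1 ^+ 2)%:E.
Proof.
move=> rLah_neq0 X_law.
pose p j := (rLah r n k)^-1 * (rstirling1 r n j * rstirling2 r j k).
have sum_p : \sum_(k <= j < n.+1) p j = 1 by rewrite -mulr_sumr mulVf.
have sum_ffact i :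
    \sum_(k <= j < n.+1) (j ^_ i)%:R * p j = rLah_ffact_moment r n k i.
  rewrite /rLah_ffact_moment mulr_suml.
  by apply: eq_bigr => j _; rewrite mulrCA mulrC.
rewrite (@variance_finite_support _ _ _ _ _ _ (index_iota k n.+1)
  (GRing.natmul 1) p) //.
- rewrite -!sum_ffact -big_split /=.
  congr (_ - _ ^+ 2)%:E; apply: eq_bigr => j _.
    rewrite -mulrDl -natrX -natrD ffactn1; congr (_%:R * _).
    by case: j => // j; rewrite ffactnS ffactn1 mulSn mulnC; lia.
  by rewrite ffactn1.
- exact: iota_uniq.
- by move=> i j _ _ /eqP; rewrite eqr_nat => /eqP.
- by move=> j; rewrite mem_index_iota => ?; apply: X_law.
Qed.

Theorem theorem3p7 (R : realType) (d : measure_display) (T : measurableType d)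
    (P : probability T R) (X : {RV P >-> R}) (n k : nat) (r : R)
    (hadm : rLah_admissible n k r) (hX : rLah_distributed X n k r) :
  let N : R := n%:R in
  let K : R := k%:R in
  let H1 : R := harmonic_diff 1 (K + 2 * r - 1) (n - k + 1) in
  let H2 : R := harmonic_diff 2 (K + 2 * r - 1) (n - k + 1) in
  'V_P[X] =
  (1 / ((N - K + 1) * (N - K + 2))
   * ((r * (N ^+ 2 + 3 * N + 2) + K ^+ 2 * (N + r)
       + K * (N ^+ 2 + r + 2 * N * r)) * H1
      - (r ^+ 2 * (N ^+ 2 + 3 * N + 2) + K ^+ 2 * (N + r) ^+ 2
         + K * (2 * N ^+ 2 * r + r * (2 + r)
                + N * (1 + 2 * r + 2 * r ^+ 2))) * H2
      - (K * (N + 1) * (N + 2 * r) * (K + 2 * r - 1) / (N - K + 1)) * H1 ^+ 2)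
   - (r * N + r ^+ 2) / (N + 2 * r) ^+ 2)%:E.
Proof.
move=> N K H1 H2; have [_ k_le_n _ _] := hadm.
have a_gt0 := rLah_admissible_gt0 hadm.
have v_neq0 := lt0r_neq0 (addr_natr_gt0W k_le_n a_gt0).
have rLah_neq0 := lt0r_neq0 (rLah_gt0 k_le_n a_gt0).
have NK : (n - k)%:R = N - K by rewrite natrB.
have NK1_neq0 : N - K + 1 != 0 by rewrite -NK natr1 pnatr_eq0.
have NK2_neq0 : N - K + 2 != 0 by rewrite -NK -natrD addn2 pnatr_eq0.
rewrite (rLah_variance_ffact_moment rLah_neq0 hX).
rewrite rLah_ffact_moment1 // rLah_ffact_moment2 // NK -[(n - k).+1]addn1.
by rewrite -/H1 -/H2; congr EFin; field; apply/and3P.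
Qed.
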